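(* Let $(G,c)$ be an infinite network, let $S\subset \mathcal H_{\mathcal E}\subset S'$ be a Gel'fand triple obtained by construction (A) or (B) of the context, with associated Gaussian probability measure $\mathbb P$ on $S'$. For any $u\in\mathrm{Harm}$ and every vertex $x\in G$, with $h_x:=P_{\mathrm{Harm}}v_x$, $$u(x)=\int_{S'}u(\xi)\,h_x(\xi)\,d\mathbb P(\xi)+u(o),$$ where inside the integral $u(\xi):=\tilde u(\xi)$ and $h_x(\xi):=\tilde h_x(\xi)$ denote the Wiener transforms of $u$ and $h_x$.
   Context: Network: a vertex set $G$ with conductances $c_{xy}=c_{yx}\in[0,\infty)$, $c_{xx}=0$; $x\sim y$ iff $c_{xy}>0$; the resulting graph is connected, and $c(x):=\sum_{y\sim x}c_{xy}<\infty$ for every $x$. Fix a vertex $o$. Laplacian: $(\Delta v)(x)=\sum_{y\sim x}c_{xy}(v(x)-v(y))$. Energy: $\mathcal E(u,v)=\frac12\sum_{x,y}c_{xy}(\overline{u(x)}-\overline{u(y)})(v(x)-v(y))$. $\mathcal H_{\mathcal E}$ is the Hilbert space of functions on $G$ with $\mathcal E(u,u)<\infty$ modulo constants, with inner product $\langle u,v\rangle_{\mathcal E}=\mathcal E(u,v)$. The energy kernel $v_x\in\mathcal H_{\mathcal E}$ is the unique element with $\langle v_x,u\rangle_{\mathcal E}=u(x)-u(o)$ for all $u\in\mathcal H_{\mathcal E}$. $\delta_x\in \mathcal H_{\mathcal E}$ is the class of the characteristic function of $\{x\}$. $\mathrm{Fin}$ is the closure of $\operatorname{span}\{\delta_x\}$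 in $\mathcal H_{\mathcal E}$, $\mathrm{Harm}=\{v\in\mathcal H_{\mathcal E}:\Delta v(x)=0\ \forall x\}$, and $\mathcal H_{\mathcal E}=\mathrm{Fin}\oplus\mathrm{Harm}$ (orthogonal sum); $P_{\mathrm{Harm}}$ is the orthogonal projection on $\mathrm{Harm}$. In the construction of $S$, $S'$ all functions are real-valued, i.e. $\mathcal H_{\mathcal E}$ is replaced by its real form. Construction (A): enumerate $G\setminus\{o\}=\{x_1,x_2,\dots\}$, let $\{\varepsilon_n\}$ be the orthonormal basis obtained by Gram-Schmidt from $v_{x_1},v_{x_2},\dots$; let $\Lambda$ be the self-adjoint operator with $\Lambda\varepsilon_n=n\varepsilon_n$ (closure from $\operatorname{span}\{\varepsilon_n\}$). Construction (B) (for networks on which $\Delta$ is unbounded on $\mathcal H_{\mathcal E}$): let $f_x$ be the orthogonal projection of $v_x$ on $\mathrm{Fin}$; a monopole at $x$ is $w\in\mathcal H_{\mathcal E}$ with $\Delta w=\delta_x$ pointwise; if monopoles exist let $w_o$ be the monopole at $o$ of minimal energy. Let $\mathcal M=\operatorname{span}\{v_x\}_{x}+\operatorname{span}\{v_x+w_o,\,f_x+w_o\}_x$ (the second summand being omitted if there are no monopoles). $\Delta_M$ is the closure in $\mathcal H_{\mathcal E}$ of $\Delta$ with domain $\mathcal M$, and $\Lambda$ is a self-adjoint extension of $\Delta_M$. In both cases $S=\bigcap_{p\ge1}\operatorname{dom}(\Lambda^p)$ with the Fréchet topology given by the seminorms $u\mapsto\|\Lambda^pu\|_{\mathcal E}$,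 $p=0,1,2,\dots$, and $S'$ is the space of real continuous linear functionals on $S$, $\langle u,\xi\rangle:=\xi(u)$. ''Gel'fand triple'' means here that $S$ is dense in $\mathcal H_{\mathcal E}$, the inclusion $S\hookrightarrow\mathcal H_{\mathcal E}$ is continuous and nuclear, and $\mathcal H_{\mathcal E}\hookrightarrow S'$ via $v\mapsto\langle\cdot,v\rangle_{\mathcal E}$. By Minlos' theorem there is then a unique Radon probability measure $\mathbb P$ on $S'$ with $\int_{S'}e^{i\langle u,\xi\rangle}d\mathbb P(\xi)=e^{-\frac12\|u\|_{\mathcal E}^2}$ for all $u\in S$. Wiener transform: for $v\in S$, $\tilde v(\xi)=\xi(v)$; for real-valued $v\in\mathcal H_{\mathcal E}$, $\tilde v$ is the $L^2(S',\mathbb P)$-limit of $\tilde v_n$ for any $v_n\in S$ with $v_n\to v$ in $\mathcal H_{\mathcal E}$; for complex-valued $v=v_1+iv_2$, $\tilde v=\tilde v_1+i\tilde v_2$. *)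

(* Defs.v *)
From HB Require Import structures.
From mathcomp Require Import all_boot all_order all_algebra.
From mathcomp Require Import all_classical all_reals all_analysis.
From mathcomp.real_closed Require Import complex.

Set Implicit Arguments.
Unset Strict Implicit.
Unset Printing Implicit Defensive.

Import Order.TTheory GRing.Theory Num.Theory.
Import numFieldNormedType.Exports.

Local Open Scope classical_set_scope.
Local Open Scope ring_scope.
Local Open Scope complex_scope.

(* Elements of the energy space are functions modulo constants.  They are
   represented throughout by functions of finite energy; every notion below is
   invariant under adding constants, and [eqHE] is equality in the quotient. *)

Record network (R : realType) (G : choiceType) := Network {
  cond :> G -> G -> R ;
  cond_ge0 : forall x y, 0 <= cond x y ;
  cond_sym : forall x y, cond x y = cond y x ;
  cond_diag : forall x, cond x x = 0 ;
  cond_connected : forall x y,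
    exists s, path (fun a b => 0 < cond a b) x s /\ last x s = y ;
  cond_total_fin : forall x,
    (\esum_(y in [set y | (0 < cond x y)%R]) (cond x y)%:E < +oo)%E }.

(* Unordered sums of absolutely summable families; the value is junk when the
   family is not absolutely summable.  By Cauchy-Schwarz, the sums in
   [laplacian] and [energy] are absolutely convergent on [HE]. *)
Definition rsum (R : realType) (T : choiceType) (D : set T) (f : T -> R) : R :=
  fine (\esum_(i in D) (Num.max (f i) 0)%:E)
  - fine (\esum_(i in D) (Num.max (- f i) 0)%:E).

Definition csum (R : realType) (T : choiceType) (D : set T) (f : T -> R[i])
    : R[i] :=
  rsum D (fun i => complex.Re (f i)) +i* rsum D (fun i => complex.Im (f i)).

(* [f] is the orthogonal projection of [v] on the subspace [F], for the
   (semi-definite) inner product [form]. *)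
Definition is_orthproj (K : nmodType) (V : zmodType) (form : V -> V -> K)
    (F : set V) (v f : V) : Prop :=
  F f /\ forall g, F g -> form g (v - f) = 0.

Section ComplexEnergySpace.
Context (R : realType) (G : choiceType) (N : network R G) (o : G).

Definition laplacian (u : G -> R[i]) : G -> R[i] := fun x =>
  csum [set y | 0 < N x y] (fun y => (N x y)%:C * (u x - u y)).

Definition energy (u v : G -> R[i]) : R[i] :=
  2^-1 * csum [set: G * G] (fun p =>
    (N p.1 p.2)%:C * ((u p.1)^* - (u p.2)^*) * (v p.1 - v p.2)).

Definition HE : set (G -> R[i]) := [set u |
  (\esum_(p in [set: G * G])
     (N p.1 p.2 * ComplexField.Normc.normc (u p.1 - u p.2) ^+ 2)%:E < +oo)%E].

Definition Harm : set (G -> R[i]) :=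
  [set u | HE u /\ forall x, laplacian u x = 0].

Definition is_energy_kernel (x : G) (v : G -> R[i]) : Prop :=
  HE v /\ forall u, HE u -> energy v u = u x - u o.

End ComplexEnergySpace.

Section RealForm.
Context (R : realType) (G : choiceType) (N : network R G) (o : G).
Implicit Types u v : G -> R.

Definition cplx u : G -> R[i] := fun x => (u x)%:C.

Definition rHE : set (G -> R) := [set u | HE N (cplx u)].

Definition renergy u v : R := complex.Re (energy N (cplx u) (cplx v)).

Definition enorm u : R := Num.sqrt (renergy u u).

Definition rlaplacian u : G -> R :=
  fun x => complex.Re (laplacian N (cplx u) x).

Definition is_rkernel (x : G) v : Prop := is_energy_kernel N o x (cplx v).

Definition eqHE u v : Prop := exists k : R, forall x, u x = v x + k.

Definition delta (x : G) : G -> R := fun y => (y == x)%:R.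

Definition lspan (A : set (G -> R)) : set (G -> R) := [set u |
  exists (n : nat) (a : 'I_n -> R) (f : 'I_n -> G -> R),
    (forall i, A (f i)) /\ u = (fun x => \sum_(i < n) a i * f i x)].

Definition eclosure (A : set (G -> R)) : set (G -> R) := [set u |
  rHE u /\ forall e, 0 < e -> exists v, A v /\ enorm (u - v) < e].

Definition Fin : set (G -> R) := eclosure (lspan (range delta)).

Definition is_monopole (x : G) (w : G -> R) : Prop :=
  rHE w /\ forall y, rlaplacian w y = delta x y.

Definition is_min_monopole (x : G) (w : G -> R) : Prop :=
  is_monopole x w /\ forall w', is_monopole x w' -> enorm w <= enorm w'.

(* Partially defined operators in the real energy space; the values of [oper]
   outside of [dom] are irrelevant. *)
Record operator := Operator {
  dom : set (G -> R) ;
  oper : (G -> R) -> (G -> R) }.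

Definition is_linear_operator (L : operator) : Prop :=
  [/\ forall u, dom L u -> rHE u /\ rHE (oper L u),
      dom L (fun=> 0),
      forall u v, dom L u -> eqHE u v -> dom L v /\ eqHE (oper L u) (oper L v)
    & forall (a : R) u v, dom L u -> dom L v ->
        dom L (fun x => a * u x + v x) /\
        eqHE (oper L (fun x => a * u x + v x))
             (fun x => a * oper L u x + oper L v x)].

Definition graph (L : operator) : set ((G -> R) * (G -> R)) :=
  [set p | [/\ rHE p.1, rHE p.2, dom L p.1 & eqHE (oper L p.1) p.2]].

Definition adjoint_graph (L : operator) : set ((G -> R) * (G -> R)) :=
  [set p | [/\ rHE p.1, rHE p.2 &
    forall v, dom L v -> renergy (oper L v) p.1 = renergy v p.2]].

Definition self_adjoint (L : operator) : Prop :=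
  [/\ is_linear_operator L, eclosure (dom L) = rHE
    & graph L = adjoint_graph L].

Definition graph_closure (T : set ((G -> R) * (G -> R))) :
    set ((G -> R) * (G -> R)) :=
  [set p | [/\ rHE p.1, rHE p.2 & forall e, 0 < e ->
    exists q, [/\ T q, enorm (p.1 - q.1) < e & enorm (p.2 - q.2) < e]]].

Definition gram_schmidt (v eps : nat -> G -> R) : Prop :=
  forall n,
    let w : G -> R := fun x =>
      v n x - \sum_(k < n) renergy (eps k) (v n) * eps k x in
    eps n = (fun x => (enorm w)^-1 * w x).

(* Enumerations start at 0 here, so [eps n] is the (n+1)-st basis vector and
   has eigenvalue n+1. *)
Definition diag_graph (eps : nat -> G -> R) : set ((G -> R) * (G -> R)) :=
  [set p | exists (n : nat) (a : 'I_n -> R),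
    p.1 = (fun x => \sum_(k < n) a k * eps k x) /\
    p.2 = (fun x => \sum_(k < n) a k * (k.+1%:R * eps k x))].

Definition construction_A (L : operator) : Prop :=
  exists (e : nat -> G) (v eps : nat -> G -> R),
    [/\ set_bij [set: nat] [set~ o] e,
        forall n, is_rkernel (e n) (v n),
        gram_schmidt v eps,
        self_adjoint L
      & graph L = graph_closure (diag_graph eps)].

(* The second span is {0} when there are no monopoles. *)
Definition domM : set (G -> R) := [set u |
  exists u1 u2,
    [/\ u = u1 + u2,
        lspan [set v | exists x, is_rkernel x v] u1
      & lspan [set f | exists x v w,
          [/\ is_rkernel x v, is_min_monopole o w &
              f = v + w \/
              exists2 fx, is_orthproj renergy Fin v fx & f = fx + w]] u2]].

Definition laplacian_unbounded : Prop :=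
  ~ exists C : R, forall u, rHE u -> rHE (rlaplacian u) ->
      enorm (rlaplacian u) <= C * enorm u.

Definition construction_B (L : operator) : Prop :=
  [/\ laplacian_unbounded, self_adjoint L
    & graph_closure [set p | domM p.1 /\ p.2 = rlaplacian p.1] `<=` graph L].

Definition dom_pow (L : operator) (p : nat) : set (G -> R) :=
  [set u | forall q, (q < p)%N -> dom L (iter q (oper L) u)].

Definition smooth (L : operator) : set (G -> R) :=
  \bigcap_(p in [set p | (1 <= p)%N]) dom_pow L p.

Definition seminorm (L : operator) (p : nat) u : R :=
  enorm (iter p (oper L) u).

(* Neighbourhoods of [u] for the topology of the seminorms on [smooth L]. *)
Definition smooth_nbhs (L : operator) (u : smooth L) : set_system (smooth L) :=
  filter_from [set i : nat * R | 0 < i.2]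
    (fun i => [set v : smooth L |
       forall p, (p <= i.1)%N -> seminorm L p (\val v - \val u) < i.2]).

Definition smooth_linear (L : operator) (xi : smooth L -> R) : Prop :=
  forall (a : R) (u v w : smooth L),
    \val w = (fun x => a * \val u x + \val v x) -> xi w = a * xi u + xi v.

Definition smooth_continuous (L : operator) (xi : smooth L -> R) : Prop :=
  forall u : smooth L, xi @ smooth_nbhs u --> xi u.

(* The set S' of continuous linear functionals on S = [smooth L]; as a type it
   carries the topology of pointwise convergence on S (the weak-* topology). *)
Definition dual_set (L : operator) : set {ptws smooth L -> R} :=
  [set xi | smooth_linear xi /\ smooth_continuous xi].
Arguments dual_set : clear implicits.

Definition dual (L : operator) : Type := dual_set L.

HB.instance Definition _ (L : operator) :=
  Topological.copy (dual L) (set_type (dual_set L)).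

Lemma dual_set0 (L : operator) : (fun=> 0) \in dual_set L.
Proof.
apply/mem_set; split=> [a u v w _|u]; first by rewrite mulr0 addr0.
by move=> A /nbhs_singleton A0; exists (0%N, 1) => /= [|v _]; [exact: ltr01|].
Qed.

HB.instance Definition _ (L : operator) :=
  isPointed.Build (dual L) (SigSub (dual_set0 L)).

Definition pairing (L : operator) (u : smooth L) (xi : dual L) : R :=
  (\val xi : smooth L -> R) u.

(* S' with its Borel sigma-algebra. *)
Definition dual_borel (L : operator) := g_sigma_algebraType (@open (dual L)).

Definition nuclear_inclusion (L : operator) : Prop :=
  exists (lam : nat -> R) (xi : nat -> smooth L -> R) (y : nat -> G -> R),
    [/\ cvgn (series (fun n => `|lam n|)),
        (forall n, smooth_linear (xi n)),
        (exists (m : nat) (d : R), 0 < d /\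
           forall n (u : smooth L),
             (forall p, (p <= m)%N -> seminorm L p (\val u) < d) ->
             `|xi n u| <= 1),
        (exists C : R, forall n, rHE (y n) /\ enorm (y n) <= C)
      & forall u : smooth L,
          enorm (\val u - (fun x => \sum_(k < n) lam k * xi k u * y k x))
            @[n --> \oo] --> (0 : R)].

Definition gelfand_triple (L : operator) : Prop :=
  [/\ eclosure (smooth L) = rHE,
      (forall u : smooth L,
         enorm (\val w - \val u) @[w --> smooth_nbhs u] --> (0 : R)),
      nuclear_inclusion L,
      (forall v, rHE v -> dual_set L (fun u : smooth L => renergy (\val u) v))
    & forall v, rHE v -> (forall u : smooth L, renergy (\val u) v = 0) ->
        eqHE v (fun=> 0)].

End RealForm.

Section Probability.
Context (R : realType) (d : measure_display) (T : measurableType d).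
Variable P : probability T R.

Definition cintegrable (F : T -> R[i]) : Prop :=
  P.-integrable setT (fun t => (complex.Re (F t))%:E) /\
  P.-integrable setT (fun t => (complex.Im (F t))%:E).

Definition cintegral (F : T -> R[i]) : R[i] :=
  (\int[P]_t complex.Re (F t)) +i* (\int[P]_t complex.Im (F t)).

End Probability.

Section Wiener.
Context (R : realType) (G : choiceType) (N : network R G) (L : operator R G).
Variable P : probability (dual_borel N L) R.

Definition radon : Prop :=
  forall B : set (dual_borel N L), measurable B ->
    P B = ereal_sup [set P K | K in
      [set K : set (dual N L) | compact K /\ K `<=` B]].

Definition gaussian : Prop :=
  forall u : smooth L,
    cintegral P (fun xi => cos (pairing u xi) +i* sin (pairing u xi))
    = (expR (- (2^-1 * enorm N (\val u) ^+ 2)))%:C.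

(* [f] is (a version of) the Wiener transform of the real-valued [v]; for [v]
   in S the constant sequence gives f xi = xi v almost everywhere. *)
Definition is_rwiener (v : G -> R) (f : dual_borel N L -> R) : Prop :=
  f \in Lfun P 2%:E /\
  forall vn : nat -> smooth L,
    enorm N (\val (vn n) - v) @[n --> \oo] --> (0 : R) ->
    'N[P]_2%:E[EFin \o (fun xi => pairing (vn n) xi - f xi)%R]%E
      @[n --> \oo] --> 0%E.

Definition is_wiener (v : G -> R[i]) (f : dual_borel N L -> R[i]) : Prop :=
  is_rwiener (fun x => complex.Re (v x)) (fun xi => complex.Re (f xi)) /\
  is_rwiener (fun x => complex.Im (v x)) (fun xi => complex.Im (f xi)).

End Wiener.

(* Main.v *)
(* For real u and v in the smooth space S, xi |-> xi(u) is centred Gaussian of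
   variance |u|^2: its second moment is read off the characteristic functional
   as the limit of 2 (1 - E cos(t xi(u))) / t^2, the limit being justified by
   2 (1 - cos(t x)) / t^2 <= x^2 and by Fatou's lemma.  Density of S extends
   |u|_E = |u~|_{L^2} to the whole real energy space, and polarization gives
   E[u~ v~] = <u, v>_E.  The integrand u~ h~_x carries no complex conjugate, so
   its expectation is <conj u, h_x>_E; as conj u is again harmonic, this equals
   <conj u, v_x>_E = u(x) - u(o). *)
Require Import Defs.
From HB Require Import structures.
From mathcomp Require Import all_boot all_order all_algebra.
From mathcomp Require Import all_classical all_reals all_analysis.
From mathcomp Require Import measurable_realfun.
From mathcomp.real_closed Require Import complex.
From mathcomp Require Import ring lra.
Import Order.TTheory GRing.Theory Num.Theory.
Import numFieldNormedType.Exports.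
Local Open Scope classical_set_scope.
Local Open Scope ring_scope.
Local Open Scope complex_scope.

Set Implicit Arguments.
Unset Strict Implicit.
Unset Printing Implicit Defensive.

(** * Linearity of unordered real sums on absolutely summable families *)

Section RealSums.
Context (R : realType) (T : choiceType).
Implicit Types (D : set T) (f g : T -> R).

Definition abs_summable D f := summable D (EFin \o f).

Lemma le_abs_summable D f g : (forall i, D i -> `|f i| <= `|g i|) ->
  abs_summable D g -> abs_summable D f.
Proof.
move=> fg; apply: le_lt_trans; apply: le_esum => i Di /=.
by rewrite lee_fin fg.
Qed.

Lemma abs_summableD D f g : abs_summable D f -> abs_summable D g ->
  abs_summable D (fun i => f i + g i).
Proof. by move=> sf sg; exact: (summableD sf sg). Qed.

(** Finite subsums scale exactly, and passing to the supremum gives this half. It suffices for the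
    summability of multiples; equality comes in [rsumZ], by applying it also to the inverse
    scalar. *)
Lemma esumZ_le D f (a : R) : 0 <= a -> (forall i, 0 <= f i) ->
  (\esum_(i in D) (a * f i)%:E <= a%:E * \esum_(i in D) (f i)%:E)%E.
Proof.
move=> a0 f0; apply: ge_ereal_sup => _ [A [finA AD] <-].
under eq_fsbigr do rewrite EFinM.
rewrite -ge0_mule_fsumr//.
apply: lee_wpmul2l; first by rewrite lee_fin.
by apply: ereal_sup_ubound; exists A.
Qed.

Lemma abs_summableZ D f (a : R) : abs_summable D f ->
  abs_summable D (fun i => a * f i).
Proof.
rewrite /abs_summable /summable => sf.
apply: le_lt_trans (_ : (_ <= `|a|%:E * \esum_(i in D) (`|f i|)%:E)%E) _.
  under eq_esum do rewrite /= normrM.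
  by apply: esumZ_le.
by rewrite lte_mul_pinfty// lee_fin.
Qed.

Lemma abs_summable_esum D f : (forall i, 0 <= f i) -> abs_summable D f ->
  (\esum_(i in D) (f i)%:E \is a fin_num)%E.
Proof.
move=> f0 sf; rewrite ge0_fin_numE; last first.
  by apply: esum_ge0 => i _; rewrite lee_fin.
rewrite (_ : esum _ _ = \esum_(i in D) `|(f i)%:E|)%E//.
by apply: eq_esum => i _ /=; rewrite ger0_norm.
Qed.

(** [rsum] is defined through the canonical positive and negative parts. Here any decomposition into
    non-negative summable families yields the same value, which is what additivity and scaling rely
    on. *)
Lemma rsumB D f g : (forall i, 0 <= f i) -> (forall i, 0 <= g i) ->
  abs_summable D f -> abs_summable D g ->
  rsum D (fun i => f i - g i) =
    fine (\esum_(i in D) (f i)%:E) - fine (\esum_(i in D) (g i)%:E).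
Proof.
move=> f0 g0 sf sg.
have sfg : abs_summable D (fun i => f i - g i) by exact: (summableB sf sg).
have fpos : abs_summable D (fun i => Num.max (f i - g i) 0).
  apply: le_abs_summable sfg => i _.
  by rewrite ger0_norm ?le_max ?lexx ?orbT// ge_max normr_ge0 ler_norm.
have fneg : abs_summable D (fun i => Num.max (- (f i - g i)) 0).
  apply: le_abs_summable sfg => i _.
  by rewrite ger0_norm ?le_max ?lexx ?orbT// ge_max normr_ge0 -normrN ler_norm.
have m0 (x : R) : 0 <= Num.max x 0 by rewrite le_max lexx orbT.
have := esumB sf sg (fun i _ => f0 i) (fun i _ => g0 i).
move/(congr1 fine).
rewrite [in RHS]fineB ?abs_summable_esum// => <-.
rewrite /rsum -fineB ?abs_summable_esum//; congr (fine (_ - _)).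
- by apply: eq_esum => i _; rewrite EFin_max funeposE.
- by apply: eq_esum => i _; rewrite EFin_max funenegE.
Qed.

Lemma eq_rsum D f g : (forall i, D i -> f i = g i) -> rsum D f = rsum D g.
Proof.
move=> fg; rewrite /rsum.
by congr (fine _ - fine _); apply: eq_esum => i /fg ->.
Qed.

Lemma rsumN D f : rsum D (fun i => - f i) = - rsum D f.
Proof.
rewrite /rsum opprB; congr (_ - fine _).
by apply: eq_esum => i _; rewrite opprK.
Qed.

Lemma rsum_ge0 D f : (forall i, D i -> 0 <= f i) -> 0 <= rsum D f.
Proof.
move=> f0; rewrite /rsum [X in _ - fine X]esum1 ?subr0.
  by apply/fine_ge0/esum_ge0 => i _; rewrite lee_fin le_max lexx orbT.
by move=> i Di; congr EFin; apply/max_idPr; rewrite oppr_le0 f0.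
Qed.

Let pos f i := Num.max (f i) 0.
Let neg f i := Num.max (- f i) 0.

Let posB f i : f i = pos f i - neg f i.
Proof.
rewrite /pos /neg; have [f0|f0] := leP (f i) 0.
  by rewrite max_l ?oppr_ge0// sub0r opprK.
by rewrite max_r ?subr0// oppr_le0 ltW.
Qed.

Let pos_ge0 f i : 0 <= pos f i. Proof. by rewrite le_max lexx orbT. Qed.
Let neg_ge0 f i : 0 <= neg f i. Proof. by rewrite le_max lexx orbT. Qed.

Let sumpos D f : abs_summable D f -> abs_summable D (pos f).
Proof.
apply: le_abs_summable => i _.
by rewrite ger0_norm// ge_max normr_ge0 ler_norm.
Qed.

Let sumneg D f : abs_summable D f -> abs_summable D (neg f).
Proof.
apply: le_abs_summable => i _.
by rewrite ger0_norm// ge_max normr_ge0 -normrN ler_norm.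
Qed.

(** The positive part of a sum is not the sum of the positive parts, so [f + g] is regrouped as a
    difference of sums of parts and [rsumB] is applied. *)
Lemma rsumD D f g : abs_summable D f -> abs_summable D g ->
  rsum D (fun i => f i + g i) = rsum D f + rsum D g.
Proof.
move=> sf sg.
have -> : (fun i => f i + g i) =
    (fun i => (pos f i + pos g i) - (neg f i + neg g i)).
  by apply/funext => i; rewrite {1}posB {1}(posB g); ring.
rewrite rsumB; first last.
- by apply: abs_summableD; exact: sumneg.
- by apply: abs_summableD; exact: sumpos.
- by move=> i; rewrite addr_ge0.
- by move=> i; rewrite addr_ge0.
under eq_esum do rewrite EFinD.
under [X in _ - fine X]eq_esum do rewrite EFinD.
rewrite !esumD; try by move=> i _; rewrite lee_fin.
rewrite !fineD ?abs_summable_esum//; try exact: sumpos; try exact: sumneg.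
by rewrite /rsum -/pos -/neg; ring.
Qed.

Lemma rsumZ D f (a : R) : abs_summable D f ->
  rsum D (fun i => a * f i) = a * rsum D f.
Proof.
move=> sf.
have pZ (b : R) h : 0 <= b -> (forall i, 0 <= h i) -> abs_summable D h ->
    fine (\esum_(i in D) (b * h i)%:E) = b * fine (\esum_(i in D) (h i)%:E).
  move=> b0 h0 sh; have [->|bN0] := eqVneq b 0.
    rewrite mul0r esum1// => i _; by rewrite mul0r.
  have bp : 0 < b by rewrite lt_def bN0.
  rewrite -[X in X * _]/(fine b%:E) -fineM ?abs_summable_esum//; congr fine.
  (* The reverse inequality is [esumZ_le] for the family [b * h] and the scalar [b^-1]. *)
  apply/eqP; rewrite eq_le esumZ_le//=.
  have := @esumZ_le D (fun i => b * h i) b^-1.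
  rewrite invr_ge0 b0 => /(_ erefl (fun i => mulr_ge0 b0 (h0 i))).
  under eq_esum do rewrite mulKf//.
  move=> /(lee_wpmul2l (_ : (0 <= b%:E)%E)) => /(_ b0).
  by rewrite muleA -EFinM divff// mul1e.
wlog a0 : a / 0 <= a.
  move=> H; have [/H//|a0] := leP 0 a.
  transitivity (- rsum D (fun i => - a * f i)).
    by rewrite -rsumN; apply: eq_rsum => i _; rewrite mulNr opprK.
  by rewrite H ?oppr_ge0 1?ltW// mulNr opprK.
have -> : (fun i => a * f i) = (fun i => a * pos f i - a * neg f i).
  by apply/funext => i; rewrite {1}posB; ring.
rewrite rsumB; first last.
- by apply: abs_summableZ; exact: sumneg.
- by apply: abs_summableZ; exact: sumpos.
- by move=> i; rewrite mulr_ge0.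
- by move=> i; rewrite mulr_ge0.
rewrite (pZ a _ a0 (pos_ge0 f) (sumpos sf)).
by rewrite (pZ a _ a0 (neg_ge0 f) (sumneg sf)) -mulrBr.
Qed.

End RealSums.

(** * The energy form: real and imaginary parts, bilinearity, Cauchy-Schwarz *)

Section EnergyForm.
Context (R : realType) (G : choiceType) (N : network R G).
Implicit Types (f g h : G -> R) (u v : G -> R[i]).

Notation dsum f g := (fun p : G * G =>
  N p.1 p.2 * (f p.1 - f p.2) * (g p.1 - g p.2)).

Lemma half_complexM (z : R[i]) :
  2^-1 * z = (2^-1 * complex.Re z) +i* (2^-1 * complex.Im z).
Proof.
have -> : 2^-1 = (2^-1 : R)%:C by rewrite fmorphV rmorph_nat.
by case: z => a b /=; simpc.
Qed.

Lemma renergyE f g : renergy N f g = 2^-1 * rsum [set: G * G] (dsum f g).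
Proof.
rewrite /renergy /energy half_complexM /=; congr (_ * _).
by apply: eq_rsum => p _; simpc => /=; ring.
Qed.

Lemma rHE_summable f : rHE N f <-> abs_summable [set: G * G] (dsum f f).
Proof.
rewrite /rHE /HE /abs_summable /summable /=.
rewrite [X in (X < _)%E <-> _](_ : _ =
  (\esum_(p in [set: G * G]) `|(EFin \o dsum f f) p|)%E)//.
apply: eq_esum => p _ /=; rewrite ger0_norm; last first.
  by rewrite -mulrA mulr_ge0 ?cond_ge0// -expr2 sqr_ge0.
by rewrite subr0 expr0n /= addr0 sqr_sqrtr ?sqr_ge0// expr2 mulrA.
Qed.

(** Termwise the squared modulus is the sum of the squares of the real and imaginary parts, so it
    dominates each of them and is summable when both are. *)
Lemma HE_ReIm u : HE N u <->
  rHE N (fun x => complex.Re (u x)) /\ rHE N (fun x => complex.Im (u x)).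
Proof.
pose su p := N p.1 p.2 * ComplexField.Normc.normc (u p.1 - u p.2) ^+ 2.
pose re x := complex.Re (u x); pose im x := complex.Im (u x).
have suE p : su p = dsum re re p + dsum im im p.
  rewrite /su /re /im; case: (u p.1) => a b; case: (u p.2) => c d /=.
  by rewrite sqr_sqrtr ?addr_ge0 ?sqr_ge0//; ring.
have d0 f p : 0 <= dsum f f p.
  by rewrite -mulrA mulr_ge0 ?cond_ge0// -expr2 sqr_ge0.
have -> : HE N u <-> abs_summable [set: G * G] su.
  rewrite /HE /abs_summable /summable /=.
  rewrite [X in (X < _)%E <-> _](_ : _ =
    (\esum_(p in [set: G * G]) `|(EFin \o su) p|)%E)//.
  by apply: eq_esum => p _ /=; rewrite ger0_norm// mulr_ge0 ?cond_ge0 ?sqr_ge0.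
rewrite !rHE_summable -/re -/im; split=> [sum|[sre sim]].
  split; apply: le_abs_summable sum => p _.
  - rewrite suE [leLHS](ger0_norm (d0 re p)) ger0_norm ?addr_ge0//.
    by rewrite lerDl d0.
  - rewrite suE [leLHS](ger0_norm (d0 im p)) ger0_norm ?addr_ge0//.
    by rewrite lerDr d0.
have -> : su = fun p => dsum re re p + dsum im im p by apply/funext.
exact: abs_summableD.
Qed.

(** Domination by the two energies, from |ab| <= a^2 + b^2 weighted by the conductance. *)
Lemma dsum_summable f g : rHE N f -> rHE N g ->
  abs_summable [set: G * G] (dsum f g).
Proof.
move=> /rHE_summable sf /rHE_summable sg.
apply: le_abs_summable (abs_summableD sf sg) => p _.
have Np := cond_ge0 N p.1 p.2.
set a := f p.1 - f p.2; set b := g p.1 - g p.2.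
rewrite -!mulrA -mulrDr !normrM ler_wpM2l//.
rewrite [leRHS]ger0_norm; last by rewrite addr_ge0// -expr2 sqr_ge0.
rewrite -normrM.
have := sqr_ge0 (a + b); have := sqr_ge0 (a - b).
by rewrite ler_norml; clear; move: a b => a b ? ?; apply/andP; split; lra.
Qed.

Lemma rHE_lin (a : R) f g :
  rHE N f -> rHE N g -> rHE N (fun x => a * f x + g x).
Proof.
move=> hf hg; apply/rHE_summable.
have -> : dsum (fun x => a * f x + g x) (fun x => a * f x + g x) =
    (fun p => (a ^+ 2 * dsum f f p + (2 * a) * dsum f g p) + dsum g g p).
  by apply/funext => p; ring.
have [sff sfg] := (dsum_summable hf hf, dsum_summable hf hg).
apply: abs_summableD (dsum_summable hg hg).
exact: abs_summableD (abs_summableZ _ sff) (abs_summableZ _ sfg).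
Qed.

Lemma rHED f g : rHE N f -> rHE N g -> rHE N (f + g).
Proof.
move=> hf hg; have := rHE_lin 1 hf hg.
by rewrite (_ : (fun x => _) = f + g)//; apply/funext => x; rewrite mul1r.
Qed.

Lemma rHEB f g : rHE N f -> rHE N g -> rHE N (f - g).
Proof.
move=> hf hg; have := rHE_lin (-1) hg hf.
rewrite (_ : (fun x => _) = f - g)//.
by apply/funext => x; rewrite mulN1r addrC.
Qed.

Lemma renergyC f g : renergy N f g = renergy N g f.
Proof. by rewrite !renergyE; congr (_ * _); apply: eq_rsum => p _; ring. Qed.

Lemma renergy_linl (a : R) f g h : rHE N f -> rHE N g -> rHE N h ->
  renergy N (fun x => a * f x + g x) h = a * renergy N f h + renergy N g h.
Proof.
move=> hf hg hh; rewrite !renergyE.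
have -> : dsum (fun x => a * f x + g x) h =
    (fun p => a * dsum f h p + dsum g h p) by apply/funext => p; ring.
have [sf sg] := (dsum_summable hf hh, dsum_summable hg hh).
by rewrite rsumD ?rsumZ//; [ring|exact: abs_summableZ].
Qed.

Lemma renergy_linr (a : R) f g h : rHE N f -> rHE N g -> rHE N h ->
  renergy N h (fun x => a * f x + g x) = a * renergy N h f + renergy N h g.
Proof.
by move=> *; rewrite renergyC renergy_linl// ![renergy _ _ h]renergyC.
Qed.

Lemma renergyDl f g h : rHE N f -> rHE N g -> rHE N h ->
  renergy N (f + g) h = renergy N f h + renergy N g h.
Proof.
move=> hf hg hh; have := renergy_linl 1 hf hg hh; rewrite mul1r => <-.
by congr (renergy N _ h); apply/funext => x; rewrite mul1r.
Qed.

Lemma renergyBl f g h : rHE N f -> rHE N g -> rHE N h ->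
  renergy N (f - g) h = renergy N f h - renergy N g h.
Proof.
move=> hf hg hh; rewrite [RHS]addrC -[in RHS]mulN1r -renergy_linl//.
by congr (renergy N _ h); apply/funext => x; rewrite mulN1r addrC.
Qed.

Lemma renergyDr f g h : rHE N f -> rHE N g -> rHE N h ->
  renergy N h (f + g) = renergy N h f + renergy N h g.
Proof. by move=> *; rewrite renergyC renergyDl// ![renergy _ _ h]renergyC. Qed.

Lemma renergyBr f g h : rHE N f -> rHE N g -> rHE N h ->
  renergy N h (f - g) = renergy N h f - renergy N h g.
Proof. by move=> *; rewrite renergyC renergyBl// ![renergy _ _ h]renergyC. Qed.

(** [rsumN] only swaps the two parts of a sum, so finite energy does not have to be assumed, unlike
    in the linearity lemmas above. *)
Lemma renergyNl f g : renergy N (fun x => - f x) g = - renergy N f g.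
Proof.
rewrite !renergyE -mulrN -rsumN; congr (_ * _).
by apply: eq_rsum => p _; ring.
Qed.

Lemma renergy_ge0 f : 0 <= renergy N f f.
Proof.
rewrite renergyE mulr_ge0 ?invr_ge0//; apply: rsum_ge0 => p _.
by rewrite -mulrA mulr_ge0 ?cond_ge0// -expr2 sqr_ge0.
Qed.

Lemma enorm_sqr f : enorm N f ^+ 2 = renergy N f f.
Proof. by rewrite sqr_sqrtr ?renergy_ge0. Qed.

Lemma enorm_ge0 f : 0 <= enorm N f.
Proof. exact: sqrtr_ge0. Qed.

(** The quadratic [Q] in [a], the energy of [a f + g], is never negative. The form is only
    semi-definite on functions, so a zero leading coefficient is treated apart. *)
Lemma renergy_CauchySchwarz f g : rHE N f -> rHE N g ->
  renergy N f g ^+ 2 <= renergy N f f * renergy N g g.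
Proof.
move=> hf hg.
have Q (a : R) :
    0 <= a ^+ 2 * renergy N f f + 2 * a * renergy N f g + renergy N g g.
  have := renergy_ge0 (fun x => a * f x + g x).
  have hl := rHE_lin a hf hg.
  rewrite renergy_linl// !renergy_linr// [renergy N g f]renergyC.
  by congr (_ <= _); ring.
have f0 := renergy_ge0 f; have g0 := renergy_ge0 g.
move: (renergy N f g) (renergy N f f) (renergy N g g) f0 g0 Q => b a c a0 c0 Q.
have [a00|aN0] := eqVneq a 0.
  suff -> : b = 0 by rewrite a00 expr0n mul0r.
  apply/eqP; rewrite -sqrf_eq0; apply/eqP.
  have [//|bN] := eqVneq (b ^+ 2) 0.
  have bp : 0 < b ^+ 2 by rewrite lt_def bN sqr_ge0.
  (* With zero leading coefficient [Q] is affine; at this point it would equal [- c - 2], which is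
     negative. *)
  have := Q (- (c + 1) / b); rewrite a00 => Qb.
  have bn : b != 0 by rewrite -sqrf_eq0.
  have : 2 * (- (c + 1) / b) * b = - 2 * (c + 1) by field.
  by move=> Qb'; lra.
have ap : 0 < a by rewrite lt_def aN0.
(* The minimiser of the quadratic. *)
have := Q (- b / a).
have -> : (- b / a) ^+ 2 * a + 2 * (- b / a) * b + c = (a * c - b ^+ 2) / a.
  by field.
by rewrite pmulr_lge0 ?invr_gt0// subr_ge0.
Qed.

Lemma normr_renergy f g : rHE N f -> rHE N g ->
  `|renergy N f g| <= enorm N f * enorm N g.
Proof.
move=> hf hg; rewrite -(@ler_pXn2r _ 2)// ?nnegrE ?mulr_ge0 ?enorm_ge0//.
by rewrite exprMn !enorm_sqr real_normK ?num_real// renergy_CauchySchwarz.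
Qed.

(** The form is conjugate-linear in its first argument, whence the minus sign in the imaginary
    part. *)
Lemma energyE u v : HE N u -> HE N v ->
  let ru x := complex.Re (u x) in let iu x := complex.Im (u x) in
  let rv x := complex.Re (v x) in let iv x := complex.Im (v x) in
  energy N u v = (renergy N ru rv + renergy N iu iv) +i*
                 (renergy N ru iv - renergy N iu rv).
Proof.
move=> /HE_ReIm[hru hiu] /HE_ReIm[hrv hiv] ru iu rv iv.
rewrite /energy half_complexM /= !renergyE -mulrDr -mulrBr.
congr (_ +i* _); congr (_ * _).
  rewrite -rsumD; try exact: dsum_summable.
  apply: eq_rsum => p _; rewrite /ru /iu /rv /iv.
  move: (u p.1) (u p.2) (v p.1) (v p.2) => [u1 w1] [u2 w2] [v1 z1] [v2 z2].
  by simpc => /=; ring.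
have sN : abs_summable [set: G * G] (fun p => - dsum iu rv p).
  by apply: le_abs_summable (dsum_summable hiu hrv) => p _; rewrite normrN.
rewrite -rsumN -(rsumD (dsum_summable hru hiv) sN).
apply: eq_rsum => p _; rewrite /ru /iu /rv /iv.
move: (u p.1) (u p.2) (v p.1) (v p.2) => [u1 w1] [u2 w2] [v1 z1] [v2 z2].
by simpc => /=; ring.
Qed.

End EnergyForm.

(** * Reproducing formula for harmonic functions *)

Section Reproducing.
Context (R : realType) (G : choiceType) (N : network R G).

(** The conductances are real, so conjugation commutes with the Laplacian. *)
Lemma Harm_conj (u : G -> R[i]) : Harm N u -> Harm N (fun x => (u x)^*).
Proof.
move=> [hu lu]; split.
  move/HE_ReIm: hu => [hr hi]; apply/HE_ReIm; split.
    rewrite (_ : (fun x => _) = (fun x => complex.Re (u x)))//.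
    by apply/funext => x; case: (u x).
  (* The zero function, written so that its finite energy is immediate; it serves as the second term
     in [rHE_lin] with scalar -1. *)
  have h0 : rHE N (fun x => complex.Im (u x) - complex.Im (u x)) by exact: rHEB.
  have := rHE_lin (-1) hi h0.
  congr (rHE N _); apply/funext => x; case: (u x) => a b /=.
  by rewrite subrr addr0 mulN1r.
move=> x; have := lu x; rewrite /laplacian /csum => -[e1 e2].
congr (_ +i* _).
  rewrite -[RHS]e1; apply: eq_rsum => y _.
  by case: (u x) => a b; case: (u y) => c d; simpc.
rewrite -[RHS]oppr0 -[in RHS]e2 -rsumN; apply: eq_rsum => y _.
by case: (u x) => a b; case: (u y) => c d; simpc => /=; ring.
Qed.

(** The right-hand side is the complex bilinear extension of the real form at [u] and [hx], that is,
    [energy] of the conjugate of [u] with [hx]. The kernel property and the orthogonality of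
    [vx - hx] to [Harm] are both used at the conjugate of [u]. *)
Lemma Harm_reproducing (o : G) (u : G -> R[i]) (x : G) (vx hx : G -> R[i]) :
  Harm N u -> is_energy_kernel N o x vx ->
  is_orthproj (energy N) (Harm N) vx hx ->
  let ru y := complex.Re (u y) in let iu y := complex.Im (u y) in
  let rh y := complex.Re (hx y) in let ih y := complex.Im (hx y) in
  u x - u o = (renergy N ru rh - renergy N iu ih) +i*
              (renergy N ru ih + renergy N iu rh).
Proof.
move=> hu [hv kv] [[hh _] ph] ru iu rh ih.
have hc := Harm_conj hu; have [hcE _] := hc.
have := ph _ hc; have := kv _ hcE.
move: (hv) (hh) => /HE_ReIm[vr vi] /HE_ReIm[hr hi].
move: (hcE) (hu.1) => /HE_ReIm[cr ci] /HE_ReIm[ur ui].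
have hvh : HE N (vx - hx).
  apply/HE_ReIm; split.
    have := rHEB vr hr; congr (rHE N _); apply/funext => y.
    by rewrite !fctE; case: (vx y); case: (hx y).
  have := rHEB vi hi; congr (rHE N _); apply/funext => y.
  by rewrite !fctE; case: (vx y); case: (hx y).
rewrite !energyE//.
have -> : (fun y => complex.Re (u y)^*) = ru.
  by apply/funext => y; rewrite /ru; case: (u y).
have -> : (fun y => complex.Im (u y)^*) = (fun y => - iu y).
  by apply/funext => y; rewrite /iu; case: (u y).
have -> : (fun y => complex.Re ((vx - hx) y)) =
    (fun y => complex.Re (vx y)) - rh.
  by apply/funext => y; rewrite !fctE /rh; case: (vx y); case: (hx y).
have -> : (fun y => complex.Im ((vx - hx) y)) =
    (fun y => complex.Im (vx y)) - ih.
  by apply/funext => y; rewrite !fctE /ih; case: (vx y); case: (hx y).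
rewrite !renergyNl !renergyBr//.
rewrite ![renergy N (fun y => _ (vx y)) _]renergyC !renergyNl.
move=> e1 [e2 e3].
(* [e1] has [vx] in the first slot and so yields the conjugate of the wanted difference; [e2] and
   [e3] are the real and imaginary parts of orthogonality. *)
have /(congr1 conjc) : (u x)^* - (u o)^* = (u x - u o)^*.
  by case: (u x) => a b; case: (u o) => c d; simpc => /=; congr (_ +i* _); ring.
rewrite conjcK -e1 => <- /=; congr (_ +i* _); lra.
Qed.

End Reproducing.

(** * The quotient 2 (1 - cos (t x)) / t^2: limit and domination *)

Section CosineQuotient.
Context {R : realType}.

Lemma one_subr_cos (y : R) : 1 - cos y = 2 * sin (y / 2) ^+ 2.
Proof. by rewrite {1}(splitr y) cosD -!expr2 cos2sin2; ring. Qed.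

(* 2 (1 - cos (t x)) / t^2 at t = 1 / (n + 1) *)
Definition cosq (x : R) (n : nat) : R :=
  2 * n.+1%:R ^+ 2 * (1 - cos (n.+1%:R^-1 * x)).

Lemma cosq_ge0 x n : 0 <= cosq x n.
Proof. by rewrite mulr_ge0 ?mulr_ge0 ?sqr_ge0// subr_ge0 cos_le1. Qed.

(** The half-angle formula exhibits [cosq] as the square of the difference quotient at 0, with step
    [h], of the map sending [t] to [sin (x * t)]. Both the limit and the bound are read off from
    this form. *)
Lemma cosqE x n : let h : R := (2 * n.+1%:R)^-1 in
  cosq x n = (h^-1 * sin (x * h)) ^+ 2.
Proof.
rewrite /= /cosq one_subr_cos invrK.
have -> : n.+1%:R^-1 * x / 2 = x * (2 * n.+1%:R)^-1 by rewrite invfM; ring.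
ring.
Qed.

Lemma cvg_cosq x : cosq x n @[n --> \oo] --> x ^+ 2.
Proof.
pose h n : R := (2 * n.+1%:R)^-1.
have h0 : h n @[n --> \oo] --> (0 : R).
  rewrite -(mulr0 2^-1); under eq_fun do rewrite /h invfM.
  by apply: cvgMl_tmp; exact: cvg_harmonic.
(* The derivative is a limit over punctured neighbourhoods of 0, and the steps [h n] never
   vanish. *)
have h0' : h n @[n --> \oo] --> (0 : R)^'.
  move=> A A0.
  have hA : \forall n \near \oo, h n != 0 -> A (h n) by exact: (h0 _ A0).
  apply: (@filterS _ \oo _ _ _ _ hA) => n; apply.
  by rewrite /h /= invr_eq0 mulf_neq0 ?pnatr_eq0.
have d : is_derive (0 : R) 1 (fun t : R => sin (x * t)) x.
  by apply: is_derive_eq; rewrite mulr0 cos0 mul1r -[LHS]/(x * 1) mulr1.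
have dq : (fun t : R => t^-1 * sin (x * t)) t @[t --> (0 : R)^'] --> x.
  have [dv dval] := d; rewrite -[X in _ --> X]dval.
  apply: cvg_trans dv.
  apply: near_eq_cvg; near=> t.
  by rewrite /= scaler1 addr0 mulr0 sin0 subr0.
have := cvg_comp _ _ h0' dq.
move=> c; under eq_fun do rewrite cosqE.
by rewrite expr2; exact: (cvgM c c).
Unshelve. all: by end_near. Qed.

(** By the mean value theorem [sin y] is [y] times a cosine. *)
Lemma sqr_sin_le (y : R) : sin y ^+ 2 <= y ^+ 2.
Proof.
wlog y0 : y / 0 <= y.
  move=> H; have [/H//|/ltW] := leP 0 y.
  by rewrite -oppr_ge0 => /H; rewrite sinN !sqrrN.
have [c _] := MVT_segment y0 (fun x _ => is_derive_sin x)
  (continuous_subspaceT (@continuous_sin R)).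
by rewrite sin0 !subr0 => ->; rewrite exprMn ler_piMl ?sqr_ge0//.
Qed.

Lemma cosq_le x n : cosq x n <= x ^+ 2.
Proof.
rewrite cosqE; set h : R := (2 * n.+1%:R)^-1.
have h0 : 0 < h by rewrite invr_gt0 mulr_gt0.
rewrite exprMn exprVn mulrC ler_pdivrMr ?exprn_gt0//.
by rewrite -exprMn sqr_sin_le.
Qed.

End CosineQuotient.

Lemma cvgn_EFin (R : realType) (f : nat -> R) (a : R) :
  f n @[n --> \oo] --> a -> (f n)%:E @[n --> \oo] --> a%:E.
Proof. by move=> fa; apply: cvg_EFin => //; exact: nearW. Qed.

(** * Second moment from the real part of the characteristic function *)

Section SecondMoment.
Context (R : realType) d (T : measurableType d) (P : probability T R).

Lemma cos_integrable (X : T -> R) : measurable_fun setT X ->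
  P.-integrable setT (EFin \o (fun t => cos (X t))).
Proof.
move=> mX; apply: measurable_bounded_integrable => //.
- by rewrite (le_lt_trans (probability_le1 _ _))// ltry.
- apply: measurableT_comp mX.
  exact: continuous_measurable_fun (@continuous_cos R).
- exists 1; split => // M M1 t _ /=.
  by rewrite (le_trans (cos_max _))// ltW.
Qed.

(** The equality is between extended reals, so the finiteness of the second moment is part of the
    conclusion. The characteristic function is sampled along [1 / (n + 1)], a sequence tending to
    0. *)
Lemma second_moment_of_cos (X : T -> R) (s : R) :
  measurable_fun setT X -> 0 <= s ->
  (forall n, \int[P]_t cos (n.+1%:R^-1 * X t) =
    expR (- (2^-1 * (n.+1%:R^-1 ^+ 2 * s)))) ->
  (\int[P]_t (X t ^+ 2)%:E = s%:E)%E.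
Proof.
move=> mX s0 ch.
pose k n : R := 2 * n.+1%:R ^+ 2.
have k0 n : 0 < k n by rewrite mulr_gt0// exprn_gt0.
(* The expectation of [cosq (X t) n], as [cE] shows. With y = [s / k n] it is [k n] times 1 -
   exp(-y), close to [k n] times y, which is [s]. *)
pose c n := k n * (1 - expR (- (s / k n))).
have ky n : k n * (s / k n) = s by rewrite mulrC mulfVK// gt_eqF.
have mY n : measurable_fun setT (fun t => n.+1%:R^-1 * X t).
  by apply: measurable_funM => //.
have iC n := cos_integrable (mY n).
have i1 : P.-integrable setT (EFin \o (fun=> 1 : R)).
  exact: finite_measure_integrable_cst.
have iQ n : P.-integrable setT (EFin \o (fun t => cosq (X t) n)).
  pose g t := 1 - cos (n.+1%:R^-1 * X t).
  rewrite (_ : _ \o _ = (fun t => ((k n)%:E * (EFin \o g) t)%E)).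
    by apply: integrableZl => //; exact: integrableB i1 (iC n).
  by apply/funext => t /=; rewrite -EFinM.
have c1 : \int[P]_(t in setT) (1 : R) = 1.
  rewrite Rintegral_cst// mul1r -[RHS]/(fine 1%:E); congr fine.
  exact: probability_setT.
have cE n : (\int[P]_t (cosq (X t) n)%:E = (c n)%:E)%E.
  rewrite -[LHS]fineK; last exact: integrable_fin_num (iQ n).
  congr EFin; rewrite -[LHS]/(\int[P]_t (k n * (1 - cos (n.+1%:R^-1 * X t)))).
  rewrite RintegralZl//; last exact: integrableB i1 (iC n).
  rewrite RintegralB// c1 ch.
  by rewrite /c; congr (_ * (1 - expR (- _))); rewrite /k exprVn; field.
have c_le n : c n <= s.
  rewrite -[leRHS](ky n) ler_pM2l//.
  by have := expR_ge1Dx (- (s / k n)); lra.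
(* From exp(-y) <= 1/(1+y) <= 1 - y + y^2 one gets [s - s ^+ 2 / k n <= c n], and [k n] is at least
   [n + 1]. *)
have c_ge n : s - s ^+ 2 * n.+1%:R^-1 <= c n.
  set y := s / k n.
  have y0 : 0 <= y by rewrite divr_ge0// ltW.
  have e1 : expR (- y) <= (1 + y)^-1.
    rewrite expRN lef_pV2 ?posrE ?expR_gt0 ?expR_ge1Dx//; lra.
  have e2 : (1 + y)^-1 <= 1 - y + y ^+ 2.
    rewrite -[leLHS]mul1r ler_pdivrMr; last lra.
    have -> : (1 - y + y ^+ 2) * (1 + y) = 1 + y ^+ 3 by ring.
    by rewrite lerDl exprn_ge0.
  have : k n * (y - y ^+ 2) <= c n by rewrite ler_pM2l// /c; lra.
  apply: le_trans.
  have -> : k n * (y - y ^+ 2) = s - s ^+ 2 / k n.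
    by rewrite /y; have := k0 n; rewrite lt0r => /andP[? _]; field.
  rewrite lerD2l lerN2 ler_wpM2l ?sqr_ge0// lef_pV2 ?posrE ?k0//.
  have n1 : (1 : R) <= n.+1%:R by rewrite ler1n.
  by rewrite /k expr2; nra.
have cs : c n @[n --> \oo] --> s.
  apply: (@squeeze_cvgr _ _ _ _ (fun n => s - s ^+ 2 * n.+1%:R^-1) (fun=> s)).
  - by near=> n; rewrite c_ge c_le.
  - rewrite -[X in _ --> X]subr0 -(mulr0 (s ^+ 2)).
    by apply: cvgB; [exact: cvg_cst|apply: cvgMl_tmp; exact: cvg_harmonic].
  - exact: cvg_cst.
have mX2 : measurable_fun setT (EFin \o (fun t => X t ^+ 2)).
  by apply/measurable_EFinP; exact: measurable_funX.
have mQ n := measurable_int _ (iQ n).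
apply/eqP; rewrite eq_le; apply/andP; split.
  (* Fatou: the integral of the pointwise limit is at most the limit [s] of the [c n]. *)
  have Q0 n t : setT t -> (0 <= (cosq (X t) n)%:E)%E.
    by rewrite lee_fin cosq_ge0.
  have := fatou P measurableT mQ Q0.
  rewrite [X in (_ <= limn_einf X)%E -> _](_ : _ = (fun n => (c n)%:E));
    last first.
    by apply/funext => n; exact: cE.
  have [-> _] := cvg_limn_einf_sup (cvgn_EFin cs).
  apply: le_trans; rewrite le_eqVlt; apply/orP; left; apply/eqP.
  apply: eq_integral => t _; apply/esym.
  by have [-> _] := cvg_limn_einf_sup (cvgn_EFin (@cvg_cosq _ (X t))).
(* Conversely, [cosq_le] bounds each [c n] by the second moment, and [c n] tends to [s]. *)
suff H n : ((c n)%:E <= \int[P]_t (X t ^+ 2)%:E)%E.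
  by apply: (cvge_to_le (cvgn_EFin cs)); exact: nearW.
rewrite -cE; apply: ge0_le_integral => //.
- by move=> t _; rewrite lee_fin cosq_ge0.
- exact: mQ.
- by move=> t _; rewrite lee_fin cosq_le.
Unshelve. all: by end_near. Qed.

End SecondMoment.

(** * Linear structure of S and measurability of evaluations on S' *)

Section Smooth.
Context (R : realType) (G : choiceType) (N : network R G) (L : operator R G).
Context (linL : is_linear_operator N L).
Implicit Types f g : G -> R.

Lemma eqHE_sym f g : eqHE f g -> eqHE g f.
Proof. by move=> [k fg]; exists (- k) => x; rewrite fg addrK. Qed.

Lemma eqHE_trans f g h : eqHE f g -> eqHE g h -> eqHE f h.
Proof. by move=> [k fg] [l gh]; exists (l + k) => x; rewrite fg gh addrA. Qed.

Lemma smoothE f : smooth L f <-> forall q, dom L (iter q (oper L) f).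
Proof.
by split=> [Lf q|Lf q _ p _]; [exact: (Lf q.+1)|exact: Lf].
Qed.

Lemma smooth_rHE f : smooth L f -> rHE N f.
Proof. by case: linL => h _ _ _ /smoothE/(_ 0%N)/h[]. Qed.

(** [oper L] is linear only modulo constants, so its iterates at [a f + g] agree with the
    combination of iterates only up to [eqHE]. The induction carries this agreement along with
    membership in the domain. *)
Lemma smooth_lin (a : R) f g : smooth L f -> smooth L g ->
  smooth L (fun x => a * f x + g x).
Proof.
case: linL => _ _ ext lin /smoothE sf /smoothE sg; apply/smoothE => q.
suff [] : dom L (iter q (oper L) (fun x => a * f x + g x)) /\
  eqHE (iter q (oper L) (fun x => a * f x + g x))
       (fun x => a * iter q (oper L) f x + iter q (oper L) g x) by [].
elim: q => [|q [IHd IHe]].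
  by split; [exact: (lin a f g (sf 0) (sg 0)).1|exists 0 => x; rewrite addr0].
have [_ e1] := lin a _ _ (sf q) (sg q).
have [_ e2] := ext _ _ IHd IHe.
have e3 := eqHE_trans e2 e1.
split=> //=.
have [d4 _] := lin a _ _ (sf q.+1) (sg q.+1).
by have [] := ext _ _ d4 (eqHE_sym e3).
Qed.

Definition slin (a : R) (u v : smooth L) : smooth L :=
  SigSub (mem_set (smooth_lin a (set_valP u) (set_valP v))).

Lemma pairing_slin (xi : dual N L) a u v :
  pairing (slin a u v) xi = a * pairing u xi + pairing v xi.
Proof. by have [lxi _] := set_valP xi; exact: lxi. Qed.

(* [slin (a - 1) u u] plays the role of [a u]. *)
Lemma pairing_slinBl (xi : dual N L) a u :
  pairing (slin (a - 1) u u) xi = a * pairing u xi.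
Proof. by rewrite pairing_slin; ring. Qed.

(** S' has the topology of pointwise convergence, so evaluation at [u] is a coordinate projection
    after the inclusion. *)
Lemma pairing_continuous (u : smooth L) :
  continuous (pairing u : dual N L -> R).
Proof.
have cval : continuous (\val : dual N L -> {ptws smooth L -> R}).
  exact: initial_continuous.
have cproj := @proj_continuous (smooth L) (fun=> R) u.
by move=> xi; exact: (continuous_comp (cval xi) (cproj _)).
Qed.

Lemma measurable_pairing (u : smooth L) :
  measurable_fun setT (pairing u : dual_borel N L -> R).
Proof.
apply: (measurability _ (RGenOpens.measurableE R)) => _ [_ [a [b ->] <-]].
rewrite setTI; apply: sub_sigma_algebra.
by have /continuousP := @pairing_continuous u; apply; exact: interval_open.
Qed.

End Smooth.

(** * The Wiener transform as an isometry into L^2 *)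

Section Gauss.
Context (R : realType) (G : choiceType) (N : network R G) (L : operator R G).
Context (linL : is_linear_operator N L).
Context (P : probability (dual_borel N L) R) (gaussP : gaussian P).

Lemma pairing_second_moment (u : smooth L) :
  (\int[P]_xi (pairing u xi ^+ 2)%:E = (enorm N (\val u) ^+ 2)%:E)%E.
Proof.
apply: second_moment_of_cos => [||n].
- exact: measurable_pairing.
- exact: sqr_ge0.
set t := n.+1%:R^-1.
(* The characteristic functional at [t u]; its real part is the cosine integral, and the energy
   scales by [t ^+ 2]. *)
have := gaussP (slin linL (t - 1) u u).
move=> /(congr1 (@complex.Re R)) /=.
under eq_Rintegral do rewrite pairing_slinBl.
move=> ->; congr (expR (- (_ * _))).
have hu := smooth_rHE linL (set_valP u).
rewrite !enorm_sqr renergy_linl ?renergy_linr//.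
  ring.
exact: rHE_lin.
Qed.

Local Notation norm2 f := (Lnorm P 2%:E (EFin \o f%R)).
Local Notation dev v f :=
  (fun xi : dual_borel N L => (pairing v xi - f xi)%R).

Lemma Lnorm2_sqr (f : dual_borel N L -> R) (c : R) : 0 <= c ->
  norm2 f = c%:E <-> (\int[P]_xi (f xi ^+ 2)%:E = (c ^+ 2)%:E)%E.
Proof.
move=> c0.
have e : (\int[P]_xi (f xi ^+ 2)%:E = norm2 f `^ 2)%E.
  rewrite powR_Lnorm ?pnatr_eq0//; apply: eq_integral => xi _.
  by rewrite /= powR_mulrn// real_normK ?num_real.
have Nge0 := Lnorm_ge0 P 2%:E (EFin \o f).
rewrite e; split=> [->|]; first by rewrite poweR_EFin powR_mulrn.
case: (norm2 f) Nge0 => [r| |]//.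
  rewrite lee_fin => r0; rewrite poweR_EFin powR_mulrn// => -[/eqP].
  by rewrite eqrXn2// => /eqP ->.
(* An infinite norm would make the integral infinite, against the finite value [c ^+ 2]. *)
by move=> _; rewrite poweRyr ?pnatr_eq0.
Qed.

(* Weaker than [is_rwiener], which quantifies over all approximating sequences:
   a single one suffices, and this form is visibly stable under sums. *)
Definition wiener_approx (u : G -> R) (f : dual_borel N L -> R) :=
  f \in Lfun P 2%:E /\ exists vn : nat -> smooth L,
    enorm N (\val (vn n) - u) @[n --> \oo] --> (0 : R) /\
    norm2 (dev (vn n) f) @[n --> \oo] --> 0%E.

Lemma Lnorm2_pairing (u : smooth L) : norm2 (pairing u) = (enorm N (\val u))%:E.
Proof.
by apply/Lnorm2_sqr; [exact: enorm_ge0|exact: pairing_second_moment].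
Qed.

Lemma Lfun_measurable (f : dual_borel N L -> R) :
  f \in Lfun P 2%:E -> measurable_fun setT f.
Proof. by move=> /sub_Lfun_mfun; rewrite inE. Qed.

Lemma enormD (f g : G -> R) : rHE N f -> rHE N g ->
  enorm N (f + g) <= enorm N f + enorm N g.
Proof.
move=> hf hg; have hfg := rHED hf hg.
rewrite -(@ler_pXn2r _ 2)// ?nnegrE ?addr_ge0 ?enorm_ge0//.
rewrite sqrrD !enorm_sqr renergyDl// !renergyDr// [renergy N g f]renergyC.
have := le_trans (ler_norm _) (normr_renergy hf hg); lra.
Qed.

Lemma enormB (f g : G -> R) : enorm N (f - g) = enorm N (g - f).
Proof.
rewrite /enorm; congr (Num.sqrt _).
rewrite (_ : f - g = (fun x => - (g - f) x)).
  by rewrite renergyNl renergyC renergyNl opprK.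
by apply/funext => x; rewrite !fctE opprB.
Qed.

(** The reverse triangle inequality for the energy seminorm. *)
Lemma cvg_enorm (u : G -> R) (vn : nat -> smooth L) : rHE N u ->
  enorm N (\val (vn n) - u) @[n --> \oo] --> (0 : R) ->
  enorm N (\val (vn n)) @[n --> \oo] --> enorm N u.
Proof.
move=> hu vu.
have hv n := smooth_rHE linL (set_valP (vn n)).
have hd n := rHEB (hv n) hu.
apply/cvgrPdist_le => e e0; near=> n.
have : enorm N (\val (vn n) - u) <= e.
  near: n; move/cvgrPdist_le : vu => /(_ _ e0); apply: filterS => n.
  by rewrite sub0r normrN ger0_norm// enorm_ge0.
apply: le_trans; rewrite ler_distlC; apply/andP; split.
  rewrite lerBlDl; have := enormD (rHEB hu (hv n)) (hv n).
  by rewrite subrK enormB addrC.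
by have := enormD (hd n) hu; rewrite subrK addrC.
Unshelve. all: by end_near. Qed.

(** The isometry holds on S by [Lnorm2_pairing]. Minkowski's inequality bounds [f] by
    [pairing (vn n)] plus the deviation and conversely; both bounds pass to the limit. *)
Lemma wiener_approx_norm u f : rHE N u -> wiener_approx u f ->
  norm2 f = (enorm N u)%:E.
Proof.
move=> hu [fL [vn [vu vf]]].
have mf := Lfun_measurable fL.
have mp n := @measurable_pairing _ _ N _ (vn n).
have cv := cvgn_EFin (cvg_enorm hu vu).
have md n : measurable_fun setT (dev (vn n) f).
  exact: measurable_funB.
have two : (1 <= 2%:E :> \bar R)%E by rewrite lee_fin ler1n.
have c1 : ((enorm N (\val (vn n)))%:E + norm2 (dev (vn n) f))%E
    @[n --> \oo] --> (enorm N u)%:E.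
  rewrite -[X in _ --> X]adde0; apply: cvgeD => //.
apply/eqP; rewrite eq_le; apply/andP; split.
  apply: (cvge_to_ge c1); apply: nearW => n.
  rewrite -Lnorm2_pairing -(@oppe_Lnorm _ _ _ _ (EFin \o (dev (vn n) f))).
  have := eminkowski P (mp n) (measurable_funB mf (mp n)) two.
  rewrite (_ : (pairing (vn n) \+ (f \- pairing (vn n)))%R = f); last first.
    by apply/funext => xi /=; rewrite subrKC.
  congr (_ <= _ + _)%E; congr (Lnorm _ _ _).
  apply/funext => xi.
  by rewrite -[RHS]/((- (pairing (vn n) xi - f xi))%:E) opprB.
have c2 : (norm2 f + norm2 (dev (vn n) f))%E
    @[n --> \oo] --> norm2 f.
  rewrite -[X in _ --> X]adde0; apply: cvgeD => //; last exact: cvg_cst.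
  (* The limit of the sum is well defined because the second summand tends to the finite value 0. *)
  by rewrite fin_num_adde_defl.
apply: (lee_cvg_to cv c2); apply: nearW => n.
rewrite -Lnorm2_pairing.
have := eminkowski P mf (md n) two.
rewrite (_ : (f \+ _)%R = pairing (vn n))//.
by apply/funext => xi /=; rewrite subrKC.
Qed.

Lemma wiener_approxD u v f g : rHE N u -> rHE N v ->
  wiener_approx u f -> wiener_approx v g -> wiener_approx (u + v) (f \+ g).
Proof.
move=> hu hv [fL [un [uu uf]]] [gL [vn [vv vg]]].
have two : (1 <= 2%:E :> \bar R)%E by rewrite lee_fin ler1n.
have hun n := smooth_rHE linL (set_valP (un n)).
have hvn n := smooth_rHE linL (set_valP (vn n)).
have mf := Lfun_measurable fL.
have mg := Lfun_measurable gL.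
have mp w := @measurable_pairing _ _ N L w.
split; first exact: (Lfun_addr_closed P two).2.
exists (fun n => slin linL 1 (un n) (vn n)); split.
  apply: (@squeeze_cvgr _ _ _ _ (fun=> 0) (fun n =>
    enorm N (\val (un n) - u) + enorm N (\val (vn n) - v))).
  - apply: nearW => n; rewrite enorm_ge0/=.
    rewrite (_ : _ - _ = (\val (un n) - u) + (\val (vn n) - v)).
      by apply: enormD; exact: rHEB.
    by apply/funext => x; rewrite !fctE /= mul1r; ring.
  - exact: cvg_cst.
  - by rewrite -[X in _ --> X]addr0; exact: cvgD.
apply: (@squeeze_cvge _ _ _ _ (fun=> 0%E) _ (fun n =>
  (norm2 (dev (un n) f) + norm2 (dev (vn n) g))%E)).
- apply: nearW => n; rewrite Lnorm_ge0/=.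
  have := eminkowski P (measurable_funB (mp (un n)) mf)
    (measurable_funB (mp (vn n)) mg) two.
  congr (_ <= _)%E; congr (Lnorm _ _ _); apply/funext => xi /=.
  by rewrite pairing_slin; congr EFin; ring.
- exact: cvg_cst.
- by rewrite -[X in _ --> X]adde0; exact: cvgeD.
Qed.

(** Products of square-integrable functions are integrable, and the cross term is isolated by
    comparing the second moments of [f], [g] and [f + g] with the energies of [u], [v] and
    [u + v]. *)
Lemma wiener_approx_isometry u v f g : rHE N u -> rHE N v ->
  wiener_approx u f -> wiener_approx v g ->
  P.-integrable setT (EFin \o (fun xi => f xi * g xi)) /\
  \int[P]_xi (f xi * g xi) = renergy N u v.
Proof.
move=> hu hv uf vg.
have fgL := Lfun2_mul_Lfun1 uf.1 vg.1.
have ifg : P.-integrable setT (EFin \o (fun xi => f xi * g xi)).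
  exact/Lfun1_integrable.
split=> //.
have sq w h : rHE N w -> wiener_approx w h ->
    P.-integrable setT (EFin \o (fun xi => h xi ^+ 2)) /\
    \int[P]_xi (h xi ^+ 2) = renergy N w w.
  move=> hw wh; split; first exact: Lfun2_integrable_sqr wh.1.
  have /Lnorm2_sqr := wiener_approx_norm hw wh.
  by rewrite enorm_ge0 /Rintegral => /(_ isT) ->; rewrite enorm_sqr.
have [iff ef] := sq _ _ hu uf.
have [igg eg] := sq _ _ hv vg.
have [_] := sq _ _ (rHED hu hv) (wiener_approxD hu hv uf vg).
have huv := rHED hu hv.
have i2 : P.-integrable setT (EFin \o (fun xi => 2 * (f xi * g xi))).
  pose fg t := f t * g t.
  rewrite (_ : _ \o _ = (fun t => (2%:E * (EFin \o fg) t)%E)).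
    exact: integrableZl.
  by apply/funext => t /=; rewrite -EFinM.
have i3 : P.-integrable setT
    (EFin \o (fun xi => f xi ^+ 2 + 2 * (f xi * g xi))).
  exact: integrableD iff i2.
rewrite (_ : \int[P]_xi _ =
    \int[P]_xi (f xi ^+ 2 + 2 * (f xi * g xi) + g xi ^+ 2)); last first.
  by apply: eq_Rintegral => xi _ /=; ring.
rewrite RintegralD// RintegralD// RintegralZl// ef eg.
rewrite renergyDl// !renergyDr// [renergy N v u]renergyC; lra.
Qed.

(** Density of S supplies an approximating sequence with errors below [1 / (n + 1)], to which the
    universal clause of [is_rwiener] applies. *)
Lemma rwiener_approx u f : eclosure N (smooth L) = rHE N -> rHE N u ->
  is_rwiener P u f -> wiener_approx u f.
Proof.
move=> dens hu [fL cvf]; split=> //.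
have : eclosure N (smooth L) u by rewrite dens.
case=> _ app.
have /choice[vn vnP] :
    forall n : nat, exists v : smooth L, enorm N (u - \val v) < n.+1%:R^-1.
  move=> n; have [|v [sv uv]] := app n.+1%:R^-1; first by rewrite invr_gt0.
  by exists (SigSub (mem_set sv)).
have vu : enorm N (\val (vn n) - u) @[n --> \oo] --> (0 : R).
  apply: (@squeeze_cvgr _ _ _ _ (fun=> 0) (fun n => n.+1%:R^-1)).
  - apply: nearW => n; rewrite enorm_ge0/= ltW// enormB; exact: vnP.
  - exact: cvg_cst.
  - exact: cvg_harmonic.
by exists vn; split => //; exact: cvf.
Qed.

End Gauss.

(** * The integral representation of harmonic functions *)

Unset Implicit Arguments.

Theorem corollary6p1 (R : realType) (G : choiceType) (N : network R G) (o : G)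
    (hG : infinite_set [set: G])
    (L : operator R G) (hL : construction_A N o L \/ construction_B N o L)
    (hS : gelfand_triple N L)
    (P : probability (dual_borel N L) R) (hPr : radon P) (hPg : gaussian P)
    (u : G -> R[i]) (hu : Harm N u)
    (x : G) (vx hx : G -> R[i]) (hvx : is_energy_kernel N o x vx)
    (hhx : is_orthproj (energy N) (Harm N) vx hx)
    (ut ht : dual_borel N L -> R[i])
    (hut : is_wiener P u ut) (hht : is_wiener P hx ht) :
  cintegrable P (fun xi => ut xi * ht xi) /\
  u x = cintegral P (fun xi => ut xi * ht xi) + u o.
Proof.
(* Either construction makes [L] self-adjoint, which includes linearity modulo constants. *)
have linL : is_linear_operator N L.
  by case: hL => [[e [v [eps [_ _ _ [] //]]]]|[_ [] //]].
have [dens _ _ _ _] := hS.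
have /HE_ReIm[ur ui] := hu.1; have /HE_ReIm[hr hi] := hhx.1.1.
have uhE := Harm_reproducing hu hvx hhx.
have [/(rwiener_approx dens ur) aur /(rwiener_approx dens ui) aui] := hut.
have [/(rwiener_approx dens hr) ahr /(rwiener_approx dens hi) ahi] := hht.
(* The real isometry for the four pairs of real and imaginary parts; by [ReM] and [ImM] they combine
   into the bilinear expression of [uhE]. *)
have [irr err] := wiener_approx_isometry linL hPg ur hr aur ahr.
have [iri eri] := wiener_approx_isometry linL hPg ur hi aur ahi.
have [iir eir] := wiener_approx_isometry linL hPg ui hr aui ahr.
have [iii eii] := wiener_approx_isometry linL hPg ui hi aui ahi.
have ReM (z w : R[i]) : complex.Re (z * w) =
    complex.Re z * complex.Re w - complex.Im z * complex.Im w.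
  by case: z; case: w.
have ImM (z w : R[i]) : complex.Im (z * w) =
    complex.Re z * complex.Im w + complex.Im z * complex.Re w.
  by case: z; case: w.
split.
  split; under eq_fun do rewrite ?ReM ?ImM.
  - exact: integrableB irr iii.
  - exact: integrableD iri iir.
rewrite /cintegral; under eq_Rintegral do rewrite ReM.
under [X in _ +i* X]eq_Rintegral do rewrite ImM.
by rewrite RintegralB// RintegralD// err eri eir eii -uhE subrK.
Qed.
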